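(* Let $\Omega\subset\mathbb{R}^d$ be a bounded Lipschitz domain, $\Gamma\subset\partial\Omega$ a relatively open $C^1$ boundary patch with outer unit normal $\nu$, $U$ a neighbourhood of $\Gamma$, and let $(p,J)$ satisfy the continuity equation $\partial_tp+\nabla\cdot J=0$ in $(\Omega\cap U)\times(t_1,t_2)$. Suppose that on $(\Omega\cap U)\times(t_1,t_2)$: $J\in C^1$ up to $\Gamma$; $p\in C^1$ up to $\Gamma$ with $p|_\Gamma\equiv0$ and $p(x,t)\ge c\operatorname{dist}(x,\Gamma)$ for some $c>0$; and $v=J/p\in L^\infty$. If the no-flux condition $J\cdot\nu=0$ holds on $\Gamma\times(t_1,t_2)$, then $v(x,t)\cdot\nu\to0$ as $x\to\Gamma$, locally uniformly.
   Context: For $x\in\Omega$ near $\Gamma$, $\nu$ in $v(x,t)\cdot\nu$ denotes the normal at nearby boundary points (any continuous extension of $\nu$ from $\Gamma$ to a neighbourhood; since $v$ is bounded the conclusion does not depend on the extension). ''Locally uniformly'' means uniformly for the limit point in compact subsets of $\Gamma$ and $t$ in compact subsets of $(t_1,t_2)$. ''$C^1$ up to $\Gamma$'' means that the function and its first derivatives in $(x,t)$ extend continuously to $((\Omega\cap U)\cup\Gamma)\times(t_1,t_2)$. *)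

(* Defs.v *)
From HB Require Import structures.
From mathcomp Require Import all_boot all_order all_algebra.
From mathcomp Require Import all_classical all_reals all_analysis.

Set Implicit Arguments.
Unset Strict Implicit.
Unset Printing Implicit Defensive.
Import Order.TTheory GRing.Theory Num.Theory numFieldNormedType.Exports.

Local Open Scope classical_set_scope.
Local Open Scope ring_scope.

(* The library norm on 'rV[R]_d is the sup norm; lengths, unit vectors and
   distances below are Euclidean.  Topological notions are the same for both. *)
Definition dot (R : realType) (d : nat) (x y : 'rV[R]_d) : R :=
  \sum_(i < d) x 0 i * y 0 i.

Definition enorm (R : realType) (d : nat) (x : 'rV[R]_d) : R :=
  Num.sqrt (dot x x).

Definition dist (R : realType) (d : nat) (x : 'rV[R]_d) (A : set 'rV[R]_d) : R :=
  inf [set enorm (x - z) | z in A].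

Definition boundary (T : topologicalType) (A : set T) : set T :=
  closure A `\` interior A.

Definition grad (R : realType) (d : nat) (f : 'rV[R]_d -> R) (x : 'rV[R]_d)
    : 'rV[R]_d :=
  \row_(i < d) 'D_(delta_mx 0 i) f x.

(* Graph coordinates with vertical unit vector e: the height of x is dot x e and
   its horizontal part is x - dot x e *: e, which lies in the hyperplane e^perp.
   Only the restriction of F to this hyperplane matters.  graph_fun e F is
   negative exactly strictly above the graph of F. *)
Definition graph_fun (R : realType) (d : nat) (e : 'rV[R]_d)
    (F : 'rV[R]_d -> R) (x : 'rV[R]_d) : R :=
  F (x - dot x e *: e) - dot x e.

Definition local_epigraph (R : realType) (d : nat) (Omega : set 'rV[R]_d)
    (z e : 'rV[R]_d) (F : 'rV[R]_d -> R) : Prop :=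
  enorm e = 1 /\ \forall x \near z, Omega x <-> graph_fun e F x < 0.

Definition bounded_lipschitz_domain (R : realType) (d : nat)
    (Omega : set 'rV[R]_d) : Prop :=
  [/\ open Omega, connected Omega, Omega !=set0, bounded_set Omega &
      forall z, boundary Omega z ->
        exists e F (k : R), k.-lipschitz F /\ local_epigraph Omega z e F].

Definition C1_fun (R : realType) (d : nat) (F : 'rV[R]_d -> R) : Prop :=
  (forall x, differentiable F x) /\ (forall w, continuous ('D_w F)).

Definition C1_boundary_patch (R : realType) (d : nat)
    (Omega Gamma : set 'rV[R]_d) : Prop :=
  (exists2 W, open W & Gamma = boundary Omega `&` W) /\
  (forall z, Gamma z ->
    exists e F, C1_fun F /\ local_epigraph Omega z e F).

(* Omega is locally {graph_fun e F < 0}, so the normalized gradient points out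
   of Omega; the gradient is nonzero because its component along e is -1. *)
Definition outer_unit_normal (R : realType) (d : nat)
    (Omega : set 'rV[R]_d) (z n : 'rV[R]_d) : Prop :=
  exists e F, [/\ C1_fun F, local_epigraph Omega z e F &
    n = (enorm (grad (graph_fun e F) z))^-1 *: grad (graph_fun e F) z].

(* The values of f on G are those of its continuous extension, so that
   restricting f to G needs no separate trace. *)
Definition C1_up_to (R : realType) (d : nat) (V : normedModType R)
    (D G : set 'rV[R]_d) (t1 t2 : R) (f : 'rV[R]_d * R -> V) : Prop :=
  [/\ {within (D `|` G) `*` `]t1, t2[, continuous f},
      forall z, (D `*` `]t1, t2[) z -> differentiable f z &
      forall w : 'rV[R]_d * R, exists2 g : 'rV[R]_d * R -> V,
        {within (D `|` G) `*` `]t1, t2[, continuous g} &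
        forall z, (D `*` `]t1, t2[) z -> 'D_w f z = g z].

Definition dt (R : realType) (d : nat) (V : normedModType R)
    (f : 'rV[R]_d * R -> V) (z : 'rV[R]_d * R) : V :=
  'D_((0, 1) : 'rV[R]_d * R) f z.

Definition div (R : realType) (d : nat)
    (J : 'rV[R]_d * R -> 'rV[R]_d) (z : 'rV[R]_d * R) : R :=
  \sum_(i < d) 'D_((delta_mx 0 i, 0) : 'rV[R]_d * R) (fun y => J y 0 i) z.

(* Lebesgue null sets of R^d x R.  The norm on 'rV[R]_d * R is the sup norm, so
   its balls of radius r are cubes of volume (2 r)^(d+1). *)
Definition lebesgue_null (R : realType) (d : nat) (A : set ('rV[R]_d * R)) : Prop :=
  forall eps : R, 0 < eps ->
    exists (c : nat -> 'rV[R]_d * R) (r : nat -> R),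
      [/\ forall k, 0 <= r k,
          A `<=` \bigcup_k [set z | `|z - c k| <= r k] &
          forall m, \sum_(k < m) (2 * r k) ^+ d.+1 <= eps].

(* Membership in L^oo(Q); measurability is not included, since it is automatic
   for functions that are continuous on an open set Q. *)
Definition ess_bounded (R : realType) (d : nat) (Q : set ('rV[R]_d * R))
    (v : 'rV[R]_d * R -> 'rV[R]_d) : Prop :=
  exists M : R, lebesgue_null [set z | Q z /\ M < enorm (v z)].

Definition velocity (R : realType) (d : nat) (p : 'rV[R]_d * R -> R)
    (J : 'rV[R]_d * R -> 'rV[R]_d) (z : 'rV[R]_d * R) : 'rV[R]_d :=
  (p z)^-1 *: J z.

(* Main.v *)
From HB Require Import structures.
Require Import Defs.
From mathcomp Require Import all_boot all_order all_algebra.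
From mathcomp Require Import all_classical all_reals all_analysis.
From mathcomp Require Import zify ring lra.
Set Implicit Arguments.
Unset Strict Implicit.
Unset Printing Implicit Defensive.
Import Order.TTheory GRing.Theory Num.Theory numFieldNormedType.Exports.
Local Open Scope classical_set_scope.
Local Open Scope ring_scope.

(** Where p > 0 the essential bound on v gives |J| <= M p, because an open set
    is never Lebesgue null; since p vanishes on Gamma, so does the whole flux J,
    not only its normal component.  Hence the first derivatives of J at a
    boundary point have rank one: in a C^1 graph chart with defining function
    G (negative inside, zero on the boundary), the derivative of J at z0 in any
    direction w is -(dG w) a, where a is the derivative along the vertical of
    the chart ([boundary_slope]).

    The divergence of J at z0 is the trace of this rank-one matrix, that is
    -(a . grad G).  By the continuity equation it equals minus the time
    derivative of p, which is zero because p(z0, .) is identically zero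
    ([time_derivative_boundary0]).  So a . nu = 0, and the derivative of J . nu
    at z0 vanishes in every direction ([normal_flux_slope0]).

    Therefore J . nu is small compared with the height above the boundary
    ([vertical_slope]).  In a Lipschitz graph chart this height is at most a
    constant times the distance to Gamma ([lipschitz_height_le_dist]), hence at
    most a constant times p.  Dividing by p gives v . nu -> 0 at each boundary
    point; replacing nu by its continuous extension costs only |v| times a small
    quantity, and compactness makes the convergence uniform.

    Expansions at the boundary come from the mean value theorem on segments that
    enter the domain from a boundary point; the continuous extensions of the
    derivatives supply the limit slopes. *)

(** * Open sets are not Lebesgue null *)

Lemma card_ord_spread (n T : nat) (S : {set 'I_n}) :
  (forall i j : 'I_n, i \in S -> j \in S -> (j <= i + T)%N) -> (#|S| <= T.+1)%N.
Proof.
move=> spr; have [->|[i0 i0S]] := set_0Vmem S; first by rewrite cards0.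
case: (arg_minnP (fun i : 'I_n => nat_of_ord i) i0S) => i iS imin.
pose f (j : 'I_n) : 'I_T.+1 := inord (j - i).
have fK (j : 'I_n) : j \in S -> (f j : nat) = (j - i)%N.
  by move=> jS; rewrite inordK // ltnS leq_subLR; exact: spr.
rewrite -[leqRHS]card_ord; apply: (@leq_card_in _ _ f) => j k jS kS.
move=> /(congr1 (@nat_of_ord _)); rewrite !fK // => jk; apply: val_inj => /=.
by rewrite -(subnK (imin j jS)) jk subnK //; exact: imin.
Qed.

Lemma card_grid_interval (R : realType) (n T : nat) (a h c r : R) :
  0 < h -> 2 * r <= T%:R * h ->
  (#|[pred j : 'I_n | (`|(a + (j : nat)%:R * h) - c| <= r)%R]| <= T.+1)%N.
Proof.
move=> h0 rT; rewrite -cardsE; apply: card_ord_spread => i j; rewrite !inE => ir jr.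
rewrite -(ler_nat R) -(ler_pM2r h0) natrD mulrDl.
move: ir jr; rewrite !ler_norml => /andP[? ?] /andP[? ?]; lra.
Qed.

(** A cube meets a product grid in a product of one-dimensional traces; the
    time coordinate accounts for the extra dimension in the exponent. *)
Lemma card_grid_cube (R : realType) (d n T : nat) (a c : 'rV[R]_d * R) (h r : R) :
  0 < h -> 2 * r <= T%:R * h ->
  (#|[pred x : {ffun 'I_d -> 'I_n} * 'I_n |
      (`|((\row_i (a.1 0 i + (x.1 i : nat)%:R * h), a.2 + (x.2 : nat)%:R * h)
         : 'rV[R]_d * R) - c| <= r)%R]|
   <= T.+1 ^ d.+1)%N.
Proof.
move=> h0 rT.
pose F (i : 'I_d) : pred 'I_n := mem
  [pred j : 'I_n | `|(a.1 0 i + (j : nat)%:R * h) - c.1 0 i| <= r].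
pose L := [pred j : 'I_n | `|(a.2 + (j : nat)%:R * h) - c.2| <= r].
apply: (@leq_trans #|finset.setX [set f : {ffun 'I_d -> 'I_n} | f \in family F]%SET [set j | L j]%SET|).
  apply/subset_leq_card/fintype.subsetP => -[f j]; rewrite !inE /=.
  rewrite prod_normE ge_max /= => /andP[fr jr]; rewrite jr andbT.
  apply/forallP => i; rewrite inE; apply: le_trans fr.
  rewrite /Num.norm/= mx_normrE.
  by apply: le_trans (le_bigmax _ _ (ord0, i)); rewrite !mxE.
rewrite cardsX expnSr !cardsE leq_mul ?card_grid_interval // card_family.
rewrite -[d in leqRHS]card_ord cardE /image_mem; elim: (enum _) => //= i s IH.
rewrite expnS leq_mul //; exact: card_grid_interval.
Qed.

Lemma exprD_le_max (R : realType) (n : nat) (x y : R) : 0 <= x -> 0 <= y ->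
  (x + y) ^+ n <= (2 * x) ^+ n + (2 * y) ^+ n.
Proof.
move=> x0 y0; have [xy|/ltW yx] := leP x y.
  apply: (@le_trans _ _ ((2 * y) ^+ n)); last by rewrite lerDr exprn_ge0 ?mulr_ge0.
  by rewrite lerXn2r ?nnegrE ?addr_ge0 ?mulr_ge0//; lra.
apply: (@le_trans _ _ ((2 * x) ^+ n)); last by rewrite lerDl exprn_ge0 ?mulr_ge0.
by rewrite lerXn2r ?nnegrE ?addr_ge0 ?mulr_ge0//; lra.
Qed.

(** Comparing the number of points of a fine grid inside the big cube with the
    number of those that each small cube can contain. *)
Lemma finite_cube_cover_volume (R : realType) (d m : nat) (z : 'rV[R]_d * R)
    (rho : R) (c : nat -> 'rV[R]_d * R) (r : nat -> R) : 0 < rho ->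
  (forall k, 0 < r k) ->
  (forall y, `|y - z| <= rho -> exists2 k, (k < m)%N & `|y - c k| <= r k) ->
  rho ^+ d.+1 <= \sum_(k < m) (4 * r k) ^+ d.+1.
Proof.
move=> rho0 r0 cov.
(* The mesh rho / n is at most every r k, so that rounding a count up costs at
   most a factor of two; this is the factor 4 instead of 2 in the bound. *)
have [n n0 hn] : exists2 n : nat, (0 < n)%N & forall k : 'I_m, rho / n%:R <= r k.
  pose n := (\max_(k < m) (Num.truncn (rho / r k)).+1).+1.
  exists n => // k; rewrite ler_pdivrMr ?ltr0n // mulrC -ler_pdivrMr //.
  apply/ltW/(lt_le_trans (truncnS_gt _)); rewrite ler_nat /n.
  by apply: leq_trans (leqnSn _); exact: (@leq_bigmax _ (fun k : 'I_m => (Num.truncn (rho / r k)).+1)).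
have [h hE] : exists h, h = rho / n%:R by exists (rho / n%:R).
have h0 : 0 < h by rewrite hE divr_gt0 ?ltr0n.
pose pt (x : {ffun 'I_d -> 'I_n} * 'I_n) : 'rV[R]_d * R :=
  (\row_i (z.1 0 i + (x.1 i : nat)%:R * h), z.2 + (x.2 : nat)%:R * h).
have step (j : 'I_n) : `|(j : nat)%:R * h| <= rho.
  rewrite ger0_norm ?mulr_ge0 ?ler0n ?(ltW h0) // mulrC hE -mulrA ler_piMr ?(ltW rho0) //.
  by rewrite mulrC ler_pdivrMr ?ltr0n // mul1r ler_nat ltnW.
have ptz x : `|pt x - z| <= rho.
  rewrite prod_normE ge_max /=; apply/andP; split; last by rewrite addrAC subrr add0r.
  rewrite /Num.norm/= mx_normrE; apply/bigmax_leP; split; first exact: ltW.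
  by move=> [i j] _ /=; rewrite !mxE (ord1 i) addrAC subrr add0r.
pose S (k : 'I_m) := [pred x | `|pt x - c k| <= r k].
have cardS : (#|{: {ffun 'I_d -> 'I_n} * 'I_n}| <= \sum_(k < m) #|S k|)%N.
  under eq_bigr do rewrite -sum1_card.
  rewrite -sum1_card (exchange_big_dep xpredT) //=; apply: leq_sum => x _.
  have [k km xk] := cov _ (ptz x).
  by rewrite (bigD1 (Ordinal km)).
move: cardS; rewrite card_prod card_ffun !card_ord -expnSr -(ler_nat R) natr_sum.
have n0R : (0 : R) < n%:R ^+ d.+1 by rewrite exprn_gt0 // ltr0n.
have -> : rho ^+ d.+1 = h ^+ d.+1 * n%:R ^+ d.+1.
  by rewrite -exprMn hE divfK // pnatr_eq0 -lt0n.
rewrite natrX => /(ler_wpM2l (exprn_ge0 d.+1 (ltW h0)))/le_trans; apply.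
rewrite mulr_sumr; apply: ler_sum => k _.
pose T := (Num.truncn (2 * r k / h)).+1.
have Tl : 2 * r k <= T%:R * h.
  by rewrite -ler_pdivrMr //; exact/ltW/truncnS_gt.
have := card_grid_cube n z (c k) h0 Tl.
rewrite -(ler_nat R) natrX => /(ler_wpM2l (exprn_ge0 d.+1 (ltW h0)))/le_trans; apply.
rewrite -exprMn lerXn2r ?nnegrE ?mulr_ge0 ?(ltW h0) ?(ltW (r0 k)) //.
have : (Num.truncn (2 * r k / h))%:R <= 2 * r k / h.
  by rewrite truncn_le // divr_ge0 ?mulr_ge0 ?(ltW h0) ?(ltW (r0 k)).
rewrite ler_pdivlMr // => ?; have := hn k; rewrite -hE -/T => ?.
rewrite -[T.+1]addn2 natrD; rewrite /T; nra.
Qed.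

Lemma cube_compact (R : realType) (d : nat) (z : 'rV[R]_d * R) (rho : R) :
  0 <= rho -> compact [set y : 'rV[R]_d * R | `|y - z| <= rho].
Proof.
move=> rho0.
pose Kx := [set v : 'rV[R]_d |
  forall i, `[z.1 0 i - rho, z.1 0 i + rho]%classic (v ord0 i)].
have -> : [set y : 'rV[R]_d * R | `|y - z| <= rho] =
          Kx `*` `[z.2 - rho, z.2 + rho]%classic.
  apply/seteqP; split => -[x t] /=.
    rewrite prod_normE ge_max /= => /andP[xz tz]; split.
      move=> i /=; rewrite in_itv /= -ler_distlC distrC.
      apply: le_trans xz; rewrite /Num.norm/= mx_normrE.
      by apply: le_trans (le_bigmax _ _ (ord0, i)); rewrite !mxE.
    by rewrite /= in_itv /= -ler_distlC distrC.
  rewrite /= in_itv /= -ler_distlC distrC => -[xz tz].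
  rewrite prod_normE ge_max /= tz andbT /Num.norm/= mx_normrE.
  apply/bigmax_leP; split=> // -[i j] _ /=; rewrite !mxE (ord1 i).
  by have := xz j; rewrite /= in_itv /= -ler_distlC distrC.
apply: compact_setX; last exact: segment_compact.
apply: (@rV_compact R d (fun i => `[z.1 0 i - rho, z.1 0 i + rho]%classic)) => i.
exact: segment_compact.
Qed.

(** Compactness of the cube leaves finitely many of the covering cubes, once
    they have been enlarged by geometrically decreasing margins so that their
    interiors still cover. *)
Lemma cube_not_null (R : realType) (d : nat) (A : set ('rV[R]_d * R))
    (z : 'rV[R]_d * R) (rho : R) : 0 < rho ->
  (forall y, `|y - z| <= rho -> A y) -> ~ lebesgue_null A.
Proof.
move=> rho0 zA nullA.
pose D := d.+1.
(* With this volume bound the given cubes account for at most rho ^ D / 4 in the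
   grid estimate, and the margins delta k below for at most rho ^ D / 2. *)
have e0 : 0 < rho ^+ D / (4 * 4 ^+ D).
  by rewrite divr_gt0 ?mulr_gt0 ?exprn_gt0.
have [c [r [r0 Acov rsum]]] := nullA _ e0.
pose delta (k : nat) : R := rho / 32 * 2^-1 ^+ k.
have delta0 k : 0 < delta k by rewrite mulr_gt0 ?exprn_gt0 ?invr_gt0 ?divr_gt0.
pose r' k := r k + delta k.
have r'0 k : 0 < r' k by rewrite ltr_wpDl.
have cpt := @cube_compact R d z rho (ltW rho0).
have [m cov] : exists m : nat, [set y | `|y - z| <= rho] `<=`
    [set y | exists2 k, (k < m)%N & `|y - c k| <= r' k].
  have /compact_near_coveringP/(_ nat \oo
    (fun m y => exists2 k, (k < m)%N & `|y - c k| <= r' k) _) H := cpt.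
  suff : \forall m \near \oo, [set y | `|y - z| <= rho] `<=`
    [set y | exists2 k, (k < m)%N & `|y - c k| <= r' k] by case/filter_ex => m; exists m.
  apply: H => y /= /zA/Acov[k _ /= yk].
  exists ([set y' | `|y - y'| <= delta k], [set m | (k < m)%N]) => /=.
    split; last exact: nbhs_infty_gt.
    apply/nbhs_ballP; exists (delta k) => //= y'.
    by rewrite -ball_normE /=; exact: ltW.
  move=> [y' m] /= [yy' km]; exists k => //.
  by rewrite (le_trans (ler_distD y _ _)) // addrC lerD // distrC.
have := finite_cube_cover_volume rho0 r'0 (fun y => cov y).
have sumD : \sum_(k < m) (8 * delta k) ^+ D <= rho ^+ D / 2.
  apply: (@le_trans _ _ (\sum_(k < m) (rho ^+ D / 4 * 2^-1 ^+ k))).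
    apply: ler_sum => k _.
    have -> : 8 * delta k = rho * 4^-1 * 2^-1 ^+ k by rewrite /delta; field.
    rewrite !exprMn ler_pM ?mulr_ge0 ?exprn_ge0 ?invr_ge0 ?(ltW rho0) //.
      rewrite ler_wpM2l ?exprn_ge0 ?(ltW rho0)// /D exprS ler_piMr ?invr_ge0//.
      by rewrite exprn_ile1 ?invr_ge0 // invf_le1 // ler1n.
    rewrite /D exprS ler_piMr ?exprn_ge0 ?invr_ge0 // exprn_ile1 ?exprn_ge0 ?invr_ge0 //.
    by rewrite exprn_ile1 ?invr_ge0 // invf_le1 // ler1n.
  rewrite -mulr_sumr.
  have -> : \sum_(k < m) (2^-1 : R) ^+ k = 2 * (1 - 2^-1 ^+ m).
    elim: (m) => [|j IH]; first by rewrite big_ord0 expr0 subrr mulr0.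
    by rewrite big_ord_recr /= IH exprS; field.
  have : 0 <= (2^-1 : R) ^+ m by rewrite exprn_ge0 // invr_ge0.
  have : 0 < rho ^+ D by rewrite exprn_gt0.
  nra.
have sumr : \sum_(k < m) (8 * r k) ^+ D <= rho ^+ D / 4.
  have -> : \sum_(k < m) (8 * r k) ^+ D = 4 ^+ D * \sum_(k < m) (2 * r k) ^+ D.
    by rewrite mulr_sumr; apply: eq_bigr => k _; rewrite -exprMn mulrA -natrM.
  apply: le_trans (ler_wpM2l _ (rsum m)) _; first by rewrite exprn_ge0.
  by rewrite le_eqVlt; apply/orP; left; apply/eqP; field; rewrite expf_neq0.
have : \sum_(k < m) (4 * r' k) ^+ D <=
       \sum_(k < m) (8 * r k) ^+ D + \sum_(k < m) (8 * delta k) ^+ D.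
  rewrite -big_split /=; apply: ler_sum => k _.
  rewrite /r' mulrDr; apply: le_trans (exprD_le_max _ _ _) _.
  - by rewrite mulr_ge0.
  - by rewrite mulr_ge0 // ltW.
  - by rewrite !mulrA -!natrM.
have : 0 < rho ^+ D by rewrite exprn_gt0.
rewrite -/D; lra.
Qed.

(** * The Euclidean product and the mean value theorem along segments *)

Section EuclideanProduct.
Context {R : realType} {d : nat}.
Implicit Types x y e : 'rV[R]_d.

Lemma dotE x y : dot x y = (x *m y^T) 0 0.
Proof. by rewrite /dot mxE; apply: eq_bigr => i _; rewrite mxE. Qed.

Lemma dotDl x y e : dot (x + y) e = dot x e + dot y e.
Proof. by rewrite !dotE mulmxDl mxE. Qed.

Lemma dotZl (a : R) x e : dot (a *: x) e = a * dot x e.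
Proof. by rewrite !dotE -scalemxAl mxE. Qed.

Lemma dotC x y : dot x y = dot y x.
Proof. by rewrite /dot; apply: eq_bigr => i _; rewrite mulrC. Qed.

Lemma dotBl x y e : dot (x - y) e = dot x e - dot y e.
Proof. by rewrite dotDl -scaleN1r dotZl mulN1r. Qed.

Lemma dotBr e x y : dot e (x - y) = dot e x - dot e y.
Proof. by rewrite !(dotC e) dotBl. Qed.

Lemma dotZr (a : R) x e : dot e (a *: x) = a * dot e x.
Proof. by rewrite !(dotC e) dotZl. Qed.

Lemma dot_suml (I : Type) (r : seq I) (f : I -> 'rV[R]_d) e :
  dot (\sum_(i <- r) f i) e = \sum_(i <- r) dot (f i) e.
Proof. by rewrite dotE mulmx_suml summxE; apply: eq_bigr => i _; rewrite dotE. Qed.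

Lemma coord_le_norm x i : `|x 0 i| <= `|x|.
Proof.
rewrite [leRHS]/Num.norm/= mx_normrE.
by apply: le_trans (le_bigmax _ _ (ord0, i)).
Qed.

Lemma dot_le_norm x y : `|dot x y| <= d%:R * `|x| * `|y|.
Proof.
rewrite /dot; apply: le_trans (ler_norm_sum _ _ _) _.
apply: (@le_trans _ _ (\sum_(i < d) `|x| * `|y|)).
  by apply: ler_sum => i _; rewrite normrM ler_pM // coord_le_norm.
by rewrite sumr_const card_ord -[leLHS]mulr_natl mulrA.
Qed.

Lemma norm_le_enorm x : `|x| <= enorm x.
Proof.
rewrite /Num.norm/= mx_normrE; apply/bigmax_leP; split; first exact: sqrtr_ge0.
move=> [i j] _ /=; rewrite (ord1 i) -sqrtr_sqr ler_sqrt.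
  rewrite /dot (bigD1 j) //= -expr2 lerDl sumr_ge0 // => k _.
  by rewrite -expr2 sqr_ge0.
by rewrite /dot sumr_ge0 // => k _; rewrite -expr2 sqr_ge0.
Qed.

Lemma enorm_le_norm x : enorm x <= d.+1%:R * `|x|.
Proof.
rewrite -[leRHS]ger0_norm ?mulr_ge0 // -sqrtr_sqr ler_sqrt ?sqr_ge0 //.
apply: le_trans (ler_norm _) _; apply: le_trans (dot_le_norm x x) _.
rewrite exprMn -mulrA -expr2 ler_wpM2r ?sqr_ge0 // -natrX ler_nat.
by rewrite expnS expn1; nia.
Qed.

Lemma dot_enorm1 e : enorm e = 1 -> dot e e = 1.
Proof.
move=> /(congr1 (fun u => u ^+ 2)); rewrite sqr_sqrtr ?expr1n //.
by rewrite /dot sumr_ge0 // => i _; rewrite -expr2 sqr_ge0.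
Qed.

(** A name for dot in its left argument, so that it can carry a linear
    structure. *)
Definition dot_with e : 'rV[R]_d -> R := fun x => dot x e.

Fact dot_with_is_linear e : linear (dot_with e).
Proof. by move=> a x y; rewrite /dot_with dotDl dotZl. Qed.

HB.instance Definition _ e := GRing.isLinear.Build R 'rV[R]_d R *:%R
  (dot_with e) (dot_with_is_linear e).

Lemma dot_differentiable e x : differentiable (dot_with e) x.
Proof.
have -> : dot_with e = \sum_(i < d) (fun y : 'rV[R]_d => e 0 i *: (y 0 i : R)).
  apply/funext => y; rewrite fct_sumE /dot_with /dot.
  by apply: eq_bigr => i _; rewrite mulrC.
apply: differentiable_sum => i; apply: differentiableZ.
exact: differentiable_coord.
Qed.

Lemma dot_continuous e : continuous (dot_with e).
Proof. by move=> x; exact/differentiable_continuous/dot_differentiable. Qed.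

Context {V : normedModType R}.
Variables (f : V -> 'rV[R]_d) (n : 'rV[R]_d).

Lemma differentiable_dot z : differentiable f z ->
  differentiable (fun u => dot (f u) n) z.
Proof.
move=> df; apply: (@differentiable_comp _ _ _ _ f (dot_with n)) => //.
exact: dot_differentiable.
Qed.

Lemma derive_dot w z : differentiable f z ->
  'D_w (fun u => dot (f u) n) z = dot ('D_w f z) n.
Proof.
move=> df; rewrite deriveE; last exact: differentiable_dot.
rewrite (@diff_comp _ _ _ _ f (dot_with n)) //; last exact: dot_differentiable.
by rewrite /= diff_lin ?deriveE //; exact: dot_continuous.
Qed.

End EuclideanProduct.

Section MeanValue.
Context {R : realType}.

Lemma within_continuous_near {T : topologicalType} {V : normedModType R}
    (S : set T) (f : T -> V) : {within S, continuous f} ->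
  forall z, S z -> forall eps, 0 < eps ->
  \forall y \near z, S y -> `|f z - f y| < eps.
Proof.
move=> /subspace_continuousP fS z Sz eps eps0.
by have /cvgrPdist_lt/(_ _ eps0) := fS z Sz.
Qed.

(** The function is differentiable only on Q, and the starting point a may lie on
    the boundary, where mere continuity within S is enough for the mean value
    theorem. *)
Lemma MVT_ray {V : normedModType R} (S Q : set V) (f : V -> R) (a w : V) (h : R) :
  0 < h -> {within S, continuous f} -> Q `<=` S ->
  (forall z, Q z -> differentiable f z) -> S a ->
  (forall s, 0 < s <= h -> Q (a + s *: w)) ->
  exists2 xi, 0 < xi < h & f (a + h *: w) - f a = h * 'D_w f (a + xi *: w).
Proof.
move=> h0 fS QS df Sa Qray.
pose phi (s : R) := f (a + s *: w).
have dline (s : R) : is_diff s (fun s : R => a + s *: w) (fun u : R => u *: w).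
  have -> : (fun s : R => a + s *: w) = cst a + (fun s : R => s *: w) by [].
  by apply: is_diff_eq; rewrite add0r.
have dphi (s : R) : s \in `]0, h[ -> is_derive s 1 phi ('D_w f (a + s *: w)).
  rewrite in_itv /= => /andP[s0 sh].
  have dfs : differentiable f (a + s *: w) by apply: df; apply: Qray; rewrite s0 ltW.
  have dphis : differentiable phi s by apply: differentiable_comp.
  split; first exact: diff_derivable.
  rewrite !deriveE // /phi (@diff_comp _ _ _ _ (fun s : R => a + s *: w) f) //=.
  by rewrite diff_val scale1r.
have cphi : {within `[0, h], continuous phi}.
  apply/subspace_continuousP => s; rewrite /= in_itv /= => /andP[s0 sh].
  apply/cvgrPdist_lt => eps eps0.
  have Sline u : 0 <= u -> u <= h -> S (a + u *: w).
    rewrite le_eqVlt => /predU1P[<- _|u0 uh]; first by rewrite scale0r addr0.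
    by apply/QS/Qray; rewrite u0.
  have := within_continuous_near fS (Sline s s0 sh) eps0.
  have cl : {for s, continuous (fun u : R => a + u *: w)}.
    (apply: differentiable_continuous; apply: ex_diff).
  move=> /cl Hc; rewrite near_withinE; apply: (@filterS _ (nbhs s) _ _ _ _ Hc) => u /= H.
  by rewrite in_itv /= => /andP[u0 uh]; apply: H; exact: Sline.
have [xi xih] := MVT h0 dphi cphi.
rewrite /phi subr0 scale0r addr0 mulrC => E; by exists xi.
Qed.

End MeanValue.

(** * Graph charts of the boundary *)

Section GraphCharts.
Context {R : realType} {d : nat}.
Implicit Types (x y z e : 'rV[R]_d) (F : 'rV[R]_d -> R) (Omega Gamma U W : set 'rV[R]_d).

Lemma near_dist_lt {V : normedModType R} (z : V) (r : R) : 0 < r ->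
  \forall y \near z, `|z - y| < r.
Proof.
by move=> r0; apply/nbhs_ballP; exists r => // y; rewrite -ball_normE.
Qed.

Lemma lipschitz_continuous {V : normedModType R} (f : V -> R) (k : R) :
  k.-lipschitz f -> continuous f.
Proof.
move=> lipf x; apply/cvgrPdist_lt => eps eps0.
have k0 : 0 < `|k| + 1 by rewrite ltr_wpDl.
have e0 : 0 < eps / (`|k| + 1) by rewrite divr_gt0.
apply: filterS (near_dist_lt x e0) => y; rewrite ltr_pdivlMr //.
apply: le_lt_trans; have /= /le_trans := lipf (x, y) (conj I I); apply.
by rewrite mulrC ler_wpM2l // (le_trans (ler_norm _)) // lerDl.
Qed.

(** A point close to a zero of g may be moved by any amount up to |g| and still
    satisfy what holds near that zero.  With g the height over the graph, this
    controls whole vertical segments down to the boundary. *)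
Lemma near_short_shift {V : normedModType R} (g : V -> R) (w z : V) (P : set V) :
  {for z, continuous g} -> g z = 0 -> (\forall y \near z, P y) ->
  \forall y \near z, forall s, `|s| <= `|g y| -> P (y + s *: w).
Proof.
move=> cg gz /nbhs_ballP[r /= r0 rP].
have C0 : 0 < 2 * (`|w| + 1) by rewrite mulr_gt0 // ltr_wpDl.
have e0 : 0 < r / (2 * (`|w| + 1)) by rewrite divr_gt0.
have gnear : \forall y \near z, `|g z - g y| < r / (2 * (`|w| + 1)).
  by move/cvgrPdist_lt: cg => /(_ _ e0).
near=> y => s sg; apply: rP; rewrite -ball_normE /=.
have yz : `|z - y| < r / 2.
  by near: y; apply: near_dist_lt; rewrite divr_gt0.
have gy : `|g y| < r / (2 * (`|w| + 1)).
  have : `|g z - g y| < r / (2 * (`|w| + 1)).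
    by near: y.
  by rewrite gz sub0r normrN.
have -> : z - (y + s *: w) = (z - y) - s *: w by rewrite opprD addrA.
apply: le_lt_trans (ler_normB _ _) _; rewrite normrZ.
have : `|s| * (2 * (`|w| + 1)) < r.
  by rewrite -ltr_pdivlMr //; exact: le_lt_trans gy.
have := normr_ge0 s; have := normr_ge0 w; nra.
Unshelve. all: by end_near. Qed.

Lemma graph_fun_shift e F x (s : R) : enorm e = 1 ->
  graph_fun e F (x + s *: e) = graph_fun e F x - s.
Proof.
move=> /dot_enorm1 e1; rewrite /graph_fun dotDl dotZl e1 mulr1 opprD addrA.
by congr (F _ - _ - _); rewrite scalerDl opprD addrACA subrr addr0.
Qed.

Lemma horizontal_differentiable e x :
  differentiable (fun x => x - dot x e *: e) x.
Proof.
apply: differentiableB; first exact: ex_diff.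
by apply: differentiableZl; exact: (dot_differentiable e).
Qed.

Lemma graph_fun_differentiable e F x : (forall y, differentiable F y) ->
  differentiable (graph_fun e F) x.
Proof.
move=> dF; apply: differentiableB; last exact: (dot_differentiable e).
apply: (@differentiable_comp _ _ _ _ (fun x => x - dot x e *: e) F) => //.
exact: horizontal_differentiable.
Qed.

Lemma graph_fun_continuous e F : continuous F -> continuous (graph_fun e F).
Proof.
move=> cF x; apply: (@continuousB _ _ _ (F \o (fun x => x - dot x e *: e))).
  apply: continuous_comp; last exact: cF.
  exact/differentiable_continuous/horizontal_differentiable.
exact: (@dot_continuous _ _ e x).
Qed.

(** A positive value would keep a neighbourhood of z outside Omega, a negative one
    would keep it inside. *)
Lemma graph_fun_boundary0 Omega z e F : continuous F ->
  local_epigraph Omega z e F -> boundary Omega z -> graph_fun e F z = 0.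
Proof.
move=> cF [_ epi] [clz intz]; have cG := @graph_fun_continuous e F cF.
have [Gz|Gz|//] := ltgtP (graph_fun e F z) 0.
  exfalso; apply: intz; rewrite /interior.
  have : \forall x \near z, graph_fun e F x < 0 by exact: (cvgr_lt _ (cG z)).
  by apply: filter_app; apply: filterS epi => x [_ H] /H.
exfalso; have : \forall x \near z, 0 < graph_fun e F x.
  exact: (cvgr_gt _ (cG z)).
move=> /(filterI epi)/clz[x [Ox [[/(_ Ox) + _] +]]] => /lt_trans/[apply].
by rewrite ltxx.
Qed.

(** The vertical projection x + G x *: e is a zero of the graph function near z0,
    hence a boundary point, and the points above it have negative graph
    function, hence lie inside. *)
Lemma chart_foot Omega Gamma U W e F z0 : enorm e = 1 -> continuous F ->
  local_epigraph Omega z0 e F -> open W -> Gamma = boundary Omega `&` W ->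
  Gamma z0 -> open U -> U z0 ->
  \forall x \near z0, Omega x ->
    [/\ graph_fun e F x < 0, Gamma (x + graph_fun e F x *: e) &
        forall s, 0 < s <= - graph_fun e F x ->
          (Omega `&` U) (x + graph_fun e F x *: e + s *: e)].
Proof.
move=> e1 cF [_ epi] oW GW Gz0 oU Uz0.
have [bz0 Wz0] : boundary Omega z0 /\ W z0 by move: Gz0; rewrite GW.
have G0 : graph_fun e F z0 = 0 by apply: graph_fun_boundary0 bz0.
have nW : \forall x \near z0, W x by exact: open_nbhs_nbhs.
have nU : \forall x \near z0, U x by exact: open_nbhs_nbhs.
have nH := near_short_shift e (@graph_fun_continuous e F cF z0) G0
  (filterI epi (filterI nW nU)).
near=> x => Ox.
have H : forall s, `|s| <= `|graph_fun e F x| ->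
    (Omega (x + s *: e) <-> graph_fun e F (x + s *: e) < 0) /\
    (W (x + s *: e) /\ U (x + s *: e)).
  by near: x; exact: nH.
set g := graph_fun e F x.
have g0 : g < 0.
  by have [|[+ _] _] := H 0; [rewrite normr0 | rewrite scale0r addr0 => /(_ Ox)].
have up s : 0 < s <= - g -> Omega (x + g *: e + s *: e) /\ U (x + g *: e + s *: e).
  move=> /andP[s0 sg]; rewrite -addrA -scalerDl.
  have [|[_ Oepi] [_ Us]] := H (g + s).
    by rewrite -/g (ltr0_norm g0) ler_norml; apply/andP; split; lra.
  by split => //; apply: Oepi; rewrite graph_fun_shift // -/g; lra.
split => //.
have [|[Oepi _] [Wy _]] := H g; first by [].
rewrite GW; split => //; split.
  move=> B /nbhs_ballP[r /= r0 rB].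
  have C0 : 0 < 2 * (`|e| + 1) by rewrite mulr_gt0 // ltr_wpDl.
  pose s := Num.min (- g) (r / (2 * (`|e| + 1))).
  have s0 : 0 < s by rewrite lt_min divr_gt0 // oppr_gt0 g0.
  exists (x + g *: e + s *: e); split.
    by apply: (up s _).1; rewrite s0 ge_min lexx.
  apply: rB; rewrite -ball_normE /= opprD addrA subrr sub0r normrN normrZ gtr0_norm //.
  have : s * (2 * (`|e| + 1)) <= r by rewrite -ler_pdivlMr // ge_min lexx orbT.
  have := normr_ge0 e; nra.
move=> /interior_subset/Oepi; rewrite graph_fun_shift // -/g subrr.
by rewrite ltxx.
Unshelve. all: by end_near. Qed.

(** The graph function is Lipschitz and nonnegative on Gamma near z0, so its
    absolute value at x bounds the distance to nearby points of Gamma from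
    below; points of Gamma far from z0 are farther from x than the small height
    of x. *)
Lemma lipschitz_height_le_dist Omega Gamma W e F (k : R) z0 :
  k.-lipschitz F -> open Omega ->
  local_epigraph Omega z0 e F -> Gamma = boundary Omega `&` W -> Gamma z0 ->
  exists2 C, 0 < C & \forall x \near z0, - graph_fun e F x <= C * dist x Gamma.
Proof.
move=> lipF oO [e1 epi] GW Gz0.
pose L := `|k| * (1 + d%:R * `|e| * `|e|) + d%:R * `|e| + 1.
have L0 : 0 < L.
  by rewrite ltr_wpDl // addr_ge0 ?mulr_ge0 ?addr_ge0 ?mulr_ge0.
have lipG x y : graph_fun e F y - graph_fun e F x <= L * `|x - y|.
  have dn := dot_le_norm (y - x) e; rewrite dotBl in dn.
  have Fl : `|F (y - dot y e *: e) - F (x - dot x e *: e)| <=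
      `|k| * (`|y - x| + `|dot y e - dot x e| * `|e|).
    have /(_ (y - dot y e *: e, x - dot x e *: e)) := lipF.
    move=> /(_ (conj I I))/le_trans; apply => /=.
    apply: (@le_trans _ _ (`|k| * `|y - dot y e *: e - (x - dot x e *: e)|)).
      by rewrite ler_wpM2r // ler_norm.
    rewrite ler_wpM2l // -normrZ scalerBl.
    have -> : y - dot y e *: e - (x - dot x e *: e) =
       (y - x) - (dot y e *: e - dot x e *: e) by rewrite !opprD !opprK addrACA.
    exact: ler_normB.
  rewrite distrC /graph_fun /L.
  move: Fl dn; set a := F (y - _); set b := F (x - _).
  set u := dot y e; set v := dot x e => Fl dn.
  have k0 := normr_ge0 k; have n0 := normr_ge0 (y - x); have e0 := normr_ge0 e.
  have Fl2 : `|k| * (`|y - x| + `|u - v| * `|e|) <=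
     `|k| * (1 + d%:R * `|e| * `|e|) * `|y - x|.
    rewrite -mulrA ler_wpM2l // mulrDl mul1r lerD2l.
    apply: (le_trans (ler_wpM2r e0 dn)).
    by rewrite le_eqVlt; apply/orP; left; apply/eqP; ring.
  move: (le_trans Fl Fl2) dn; rewrite !ler_norml => /andP[_ ?] /andP[? _].
  nra.
exists L => //.
have ge0 : \forall z \near z0, Gamma z -> 0 <= graph_fun e F z.
  apply: filterS epi => z [_ Gz]; rewrite GW => -[[_ nint] _].
  rewrite leNgt; apply/negP => /Gz Oz; apply: nint.
  by move/interior_id: oO => ->.
have [r r0 rP] := (nbhs_ballP _ _).1 ge0.
have G0 : 0 <= graph_fun e F z0 by apply: (nbhs_singleton ge0).
have r20 : 0 < r / 2 by rewrite divr_gt0.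
have nr := near_dist_lt z0 r20.
near=> x.
have xr : `|z0 - x| < r / 2 by near: x; exact: nr.
rewrite -ler_pdivrMl //; apply: lb_le_inf; first by exists (enorm (x - z0)), z0.
move=> _ [z Gz <-]; apply: le_trans (norm_le_enorm _); rewrite ler_pdivrMl //.
(* For z outside the ball, the height of x is compared with |x - z0| instead. *)
have [zr|zr] := ltP `|z0 - z| r.
  have Gz0' : 0 <= graph_fun e F z by apply: rP Gz; rewrite -ball_normE.
  by apply: le_trans (lipG x z); lra.
apply: (@le_trans _ _ (L * `|x - z0|)).
  by apply: le_trans (lipG x z0); lra.
rewrite ler_wpM2l ?(ltW L0) //.
have := ler_distD x z0 z; rewrite (distrC x z0); lra.
Unshelve. all: by end_near. Qed.

End GraphCharts.

(** * First-order behaviour of functions vanishing on Gamma *)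

Section BoundarySlopes.
Context {R : realType} {d : nat}.
Implicit Types (e w : 'rV[R]_d) (F : 'rV[R]_d -> R) (f g : 'rV[R]_d * R -> R).
Context {Omega Gamma U W : set 'rV[R]_d} {t1 t2 : R} {z0 : 'rV[R]_d} {t0 : R}.
Context (oW : open W) (GW : Gamma = boundary Omega `&` W) (Gz0 : Gamma z0)
  (oU : open U) (Uz0 : U z0) (t0I : t1 < t0 < t2).

Local Notation Q := ((Omega `&` U) `*` `]t1, t2[).
Local Notation S := ((Omega `&` U `|` Gamma) `*` `]t1, t2[).

Lemma interior_sub_closed : Q `<=` S.
Proof. by move=> z [Qz ?]; split => //; left. Qed.

Lemma near_base_point (P : set 'rV[R]_d) : (\forall x \near z0, P x) ->
  \forall z \near (z0, t0), P z.1.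
Proof.
move=> nP; exists (P, setT); first by split => //=; exact: filterT.
by move=> [x t] [].
Qed.

(** The mean value theorem on the vertical segment from the foot of z, where f
    vanishes, up to z.  The height of z is - graph_fun e F z.1, whence the
    signs. *)
Lemma vertical_slope e F f g : continuous F -> local_epigraph Omega z0 e F ->
  {within S, continuous f} -> (forall z, Q z -> differentiable f z) ->
  (forall x t, Gamma x -> t1 < t < t2 -> f (x, t) = 0) ->
  {within S, continuous g} -> (forall z, Q z -> 'D_(e, 0) f z = g z) ->
  forall eta, 0 < eta -> \forall z \near (z0, t0), Q z ->
    `|f z + graph_fun e F z.1 * g (z0, t0)| <= eta * - graph_fun e F z.1.
Proof.
move=> cF epi cf df f0 cg fg eta eta0.
have e1 : enorm e = 1 by case: epi.
have G0 : graph_fun e F z0 = 0.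
  by apply: (graph_fun_boundary0 cF epi); move: Gz0; rewrite GW => -[].
have S0 : S (z0, t0) by split; [right | rewrite /= in_itv].
have cG : {for (z0, t0), continuous (graph_fun e F \o fst)}.
  by apply: continuous_comp; [exact: cvg_fst | exact: graph_fun_continuous].
have nfoot := near_base_point (chart_foot e1 cF epi oW GW Gz0 oU Uz0).
have nsh := near_short_shift (e, 0) cG G0 (within_continuous_near cg S0 eta0).
near=> z => -[[Oz Uz] tz].
have [Gneg foot up] : [/\ graph_fun e F z.1 < 0,
    Gamma (z.1 + graph_fun e F z.1 *: e) &
    forall s, 0 < s <= - graph_fun e F z.1 ->
      (Omega `&` U) (z.1 + graph_fun e F z.1 *: e + s *: e)].
  by move: Oz; near: z; exact: nfoot.
have close : forall s, `|s| <= `|graph_fun e F z.1| ->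
    S (z + s *: (e, 0)) -> `|g (z0, t0) - g (z + s *: (e, 0))| < eta.
  by near: z; exact: nsh.
set h := graph_fun e F z.1 in Gneg foot up close *.
have shift_t (s : R) : (z + s *: ((e, 0) : 'rV[R]_d * R)) = (z.1 + s *: e, z.2).
  by rewrite [z in LHS]surjective_pairing; congr pair; rewrite /= scaler0 addr0.
pose a := z + h *: ((e, 0) : 'rV[R]_d * R).
have Qup s : 0 < s <= - h -> Q (a + s *: (e, 0)).
  move=> sh; rewrite /a -addrA -scalerDl shift_t; split => //=.
  by rewrite scalerDl addrA; exact: up.
have Sa : S a by rewrite /a shift_t; split => //=; right.
have h0 : 0 < - h by rewrite oppr_gt0.
have [xi /andP[xi0 xih]] := MVT_ray h0 cf interior_sub_closed df Sa Qup.
rewrite fg; last by apply: Qup; rewrite xi0 ltW.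
have -> : f a = 0 by rewrite /a shift_t f0 //; move: tz; rewrite /= in_itv.
rewrite {1}/a scaleNr addrK subr0 => ->.
rewrite mulNr addrC -mulrBr normrM ltr0_norm // mulrC ler_pM2r // ltW //.
rewrite /a -addrA -scalerDl; apply: close.
  by rewrite (ltr0_norm Gneg) ler_norml; apply/andP; split; lra.
by rewrite scalerDl addrA; apply/interior_sub_closed/Qup; rewrite xi0 ltW.
Unshelve. all: by end_near. Qed.

(** The same on the segment from z0 itself in a fixed direction w. *)
Lemma inward_ray_slope w f g :
  {within S, continuous f} -> (forall z, Q z -> differentiable f z) ->
  (forall x t, Gamma x -> t1 < t < t2 -> f (x, t) = 0) ->
  {within S, continuous g} -> (forall z, Q z -> 'D_(w, 0) f z = g z) ->
  (\forall s \near 0^'+, (Omega `&` U) (z0 + s *: w)) ->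
  forall eta, 0 < eta -> \forall s \near 0^'+,
    `|f (z0 + s *: w, t0) - s * g (z0, t0)| <= eta * s.
Proof.
move=> cf df f0 cg fg ray eta eta0.
have t0I' : `]t1, t2[%classic t0 by rewrite /= in_itv.
have S0 : S (z0, t0) by split; [right |].
have shift_t (s : R) :
    (z0, t0) + s *: ((w, 0) : 'rV[R]_d * R) = (z0 + s *: w, t0).
  by congr pair; rewrite /= scaler0 addr0.
have [r r0 rP] := (nbhs_ballP _ _).1 (within_continuous_near cg S0 eta0).
have [del /= del0 delP] := (nbhs_ballP _ _).1 ray.
have C0 : 0 < `|w| + 1 by rewrite ltr_wpDl.
have m0 : 0 < Num.min del (r / (`|w| + 1)) by rewrite lt_min del0 divr_gt0.
near=> s.
have s0 : 0 < s by near: s; exact: nbhs_right_gt.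
have : s < Num.min del (r / (`|w| + 1)) by near: s; exact: nbhs_right_lt.
rewrite lt_min ltr_pdivlMr // => /andP[sdel sr].
have Qray u : 0 < u <= s -> Q ((z0, t0) + u *: (w, 0)).
  move=> /andP[u0 us]; rewrite shift_t; split => //; apply: delP => //.
  by rewrite /ball /= sub0r normrN gtr0_norm //; exact: le_lt_trans sdel.
have [xi /andP[xi0 xis]] := MVT_ray s0 cf interior_sub_closed df S0 Qray.
have Qxi : Q ((z0, t0) + xi *: (w, 0)) by apply: Qray; rewrite xi0 ltW.
rewrite fg // shift_t (f0 z0 t0) // subr0 => ->.
rewrite -mulrBr normrM gtr0_norm // mulrC ler_pM2r // distrC ltW //.
apply: rP; last exact: interior_sub_closed.
rewrite -ball_normE /= opprD addrA subrr sub0r normrN normrZ gtr0_norm //.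
have -> : `|((w, 0) : 'rV[R]_d * R)| = `|w| by rewrite prod_normE /= normr0 max_l.
have := normr_ge0 w; nra.
Unshelve. all: by end_near. Qed.

(** To first order the height along the ray is -s times the slope of the graph
    function, and is therefore positive for small s. *)
Lemma near_inward_ray e F w : (forall x, differentiable F x) ->
  local_epigraph Omega z0 e F -> 'D_w (graph_fun e F) z0 < 0 ->
  (\forall s \near 0^'+, (Omega `&` U) (z0 + s *: w)) /\
  forall eta, 0 < eta -> \forall s \near 0^'+,
    `|graph_fun e F (z0 + s *: w) - s * 'D_w (graph_fun e F) z0| <= eta * s.
Proof.
move=> dF epi; set G := graph_fun e F; set m := 'D_w G z0 => m0.
have cF : continuous F by move=> x; exact: differentiable_continuous.
have G0 : G z0 = 0.
  by apply: (graph_fun_boundary0 cF epi); move: Gz0; rewrite GW => -[].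
have dG : derivable G z0 w.
  by apply: diff_derivable; exact: graph_fun_differentiable.
have slope eta : 0 < eta -> \forall s \near 0^'+,
    `|G (z0 + s *: w) - s * m| <= eta * s.
  move=> eta0.
  have /cvgrPdist_lt/(_ _ eta0) [del /= del0 delP] :
    (fun s : R => s^-1 *: ((G \o shift z0) (s *: w) - G z0)) @ 0^' --> m by exact: dG.
  near=> s.
  have s0 : 0 < s by near: s; exact: nbhs_right_gt.
  have sd : s < del by near: s; exact: nbhs_right_lt.
  have := delP s; rewrite /= sub0r normrN gtr0_norm // => /(_ sd (lt0r_neq0 s0)).
  rewrite G0 subr0 [s *: w + _]addrC => ms.
  have -> : G (z0 + s *: w) - s * m = - s * (m - s^-1 *: G (z0 + s *: w)).
    by rewrite mulrBr /GRing.scale /= mulNr mulNr mulrA mulfV ?gt_eqF // mul1r opprK addrC.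
  by rewrite normrM normrN (gtr0_norm s0) mulrC ler_pM2r // ltW.
split => //.
have m20 : 0 < - m / 2 by rewrite divr_gt0 // oppr_gt0.
have /nbhs_ballP[r /= r0 rP] : \forall x \near z0, (Omega x <-> G x < 0) /\ U x.
  by case: epi => _ epi; apply: filterI => //; exact: open_nbhs_nbhs.
have C0 : 0 < `|w| + 1 by rewrite ltr_wpDl.
have rw0 : 0 < r / (`|w| + 1) by rewrite divr_gt0.
near=> s.
have s0 : 0 < s by near: s; exact: nbhs_right_gt.
have : s < r / (`|w| + 1) by near: s; exact: nbhs_right_lt.
rewrite ltr_pdivlMr // => sr.
have : `|G (z0 + s *: w) - s * m| <= - m / 2 * s by near: s; exact: slope.
rewrite ler_norml => /andP[_ Gs].
have [|[_ Os] Us] := rP (z0 + s *: w).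
  rewrite -ball_normE /= opprD addrA subrr sub0r normrN normrZ gtr0_norm //.
  have := normr_ge0 w; nra.
by split => //; apply: Os; nra.
Unshelve. all: by end_near. Qed.

(** The increment of f along the ray z0 + s w can be read off in two ways, from the
    ray itself and from the vertical segment below its end point, whose length
    is to first order -s times the slope of the graph function. *)
Lemma boundary_slope_inward e F w f ge gw : (forall x, differentiable F x) ->
  local_epigraph Omega z0 e F ->
  {within S, continuous f} -> (forall z, Q z -> differentiable f z) ->
  (forall x t, Gamma x -> t1 < t < t2 -> f (x, t) = 0) ->
  {within S, continuous ge} -> (forall z, Q z -> 'D_(e, 0) f z = ge z) ->
  {within S, continuous gw} -> (forall z, Q z -> 'D_(w, 0) f z = gw z) ->
  'D_w (graph_fun e F) z0 < 0 ->
  gw (z0, t0) = - 'D_w (graph_fun e F) z0 * ge (z0, t0).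
Proof.
move=> dF epi cf df f0 cge fge cgw fgw m0.
have cF : continuous F by move=> x; exact: differentiable_continuous.
have [ray Gray] := near_inward_ray dF epi m0.
set m := 'D_w _ z0 in m0 Gray *; set a := gw (z0, t0); set b := ge (z0, t0).
apply/eqP; rewrite -subr_eq0 -normr_le0; apply/ler_addgt0Pl => eps eps0.
rewrite addr0.
(* eta * C bounds the sum of the errors in the two expansions of f and in the
   expansion of the height, all divided by s. *)
pose C := 2 - m + `|b|.
have C0 : 0 < C by rewrite /C; have := normr_ge0 b; lra.
pose eta := Num.min 1 (eps / C).
have eta0 : 0 < eta by rewrite lt_min ltr01 divr_gt0.
have eta1 : eta <= 1 by rewrite ge_min lexx.
have etaC : eta * C <= eps by rewrite -ler_pdivlMr // ge_min lexx orbT.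
have [r r0 rP] := (nbhs_ballP _ _).1
  (vertical_slope cF epi cf df f0 cge fge eta0).
have C0' : 0 < `|w| + 1 by rewrite ltr_wpDl.
have rw0 : 0 < r / (`|w| + 1) by rewrite divr_gt0.
have nf := inward_ray_slope cf df f0 cgw fgw ray eta0.
have nG := Gray _ eta0.
suff [s [s0 sr [Qs fs Gs]]] : exists s, [/\ 0 < s, s < r / (`|w| + 1) &
   [/\ (Omega `&` U) (z0 + s *: w), `|f (z0 + s *: w, t0) - s * a| <= eta * s &
       `|graph_fun e F (z0 + s *: w) - s * m| <= eta * s]].
  have : `|f (z0 + s *: w, t0) + graph_fun e F (z0 + s *: w) * b| <=
      eta * - graph_fun e F (z0 + s *: w).
    apply: (rP (z0 + s *: w, t0)); last by split => //=; rewrite in_itv.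
    have -> : (z0 + s *: w, t0) = (z0, t0) + s *: ((w, 0) : 'rV[R]_d * R).
      by congr pair; rewrite /= scaler0 addr0.
    rewrite -ball_normE /= opprD addrA subrr sub0r normrN normrZ gtr0_norm //.
    rewrite prod_normE /= normr0 max_l //; move: sr; rewrite ltr_pdivlMr //.
    by have := normr_ge0 w; nra.
  move: fs Gs; set fz := f _; set G := graph_fun _ _ _ => fs Gs fv.
  rewrite -(ler_pM2l s0) -{1}(gtr0_norm s0) -normrM.
  have -> : s * (a - - m * b) = - (fz - s * a) + (fz + G * b) - (G - s * m) * b by ring.
  apply: le_trans (ler_normB _ _) _; rewrite normrM.
  apply: le_trans (lerD (ler_normD _ _) (ler_wpM2r (normr_ge0 b) Gs)) _.
  rewrite normrN; apply: le_trans (lerD (lerD fs fv) (lexx _)) _.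
  move: Gs; rewrite ler_norml => /andP[Gs _].
  apply: (@le_trans _ _ (s * (eta * C))); last by rewrite ler_wpM2l // ltW.
  have b0 := normr_ge0 b; rewrite /C.
  have : eta * - G <= eta * (s * (1 - m)).
    rewrite ler_wpM2l ?(ltW eta0) //.
    have : eta * s <= s by rewrite ler_piMl // ltW.
    by move: Gs; move: (eta * s) => es; lra.
  nra.
near (0 : R)^'+ => s.
exists s; split; [|near: s; exact: nbhs_right_lt|split].
- by near: s; exact: nbhs_right_gt.
- by near: s; exact: ray.
- by near: s; exact: nf.
- by near: s; exact: nG.
Unshelve. all: by end_near. Qed.

End BoundarySlopes.

(** * The derivatives of the flux and of the density on Gamma *)

Section LinearExtension.
Context {R : realType}.

Lemma derive_coord_sum {d : nat} {V : normedModType R} (f : 'rV[R]_d * R -> V)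
    (w : 'rV[R]_d) (z : 'rV[R]_d * R) : differentiable f z ->
  'D_(w, 0) f z =
  \sum_(i < d) w 0 i *: 'D_((delta_mx 0 i, 0) : 'rV[R]_d * R) f z.
Proof.
move=> df; rewrite deriveE //.
have -> : (w, 0) =
    \sum_(i < d) w 0 i *: ((delta_mx 0 i, 0) : 'rV[R]_d * R).
  rewrite [w in LHS]row_sum_delta.
  elim/big_rec2 : _ => [//|i y1 y2 _ <-].
  by congr pair; rewrite /= scaler0 add0r.
rewrite linear_sum; apply: eq_bigr => i _.
by rewrite linearZ deriveE.
Qed.

Lemma within_continuous_coord_sum {T : topologicalType} {d : nat} (S : set T)
    (w : 'rV[R]_d) (g : 'I_d -> T -> R) :
  (forall i, {within S, continuous (g i)}) ->
  {within S, continuous (fun z => \sum_(i < d) w 0 i * g i z)}.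
Proof.
move=> cg z; apply: cvg_big; first exact: add_continuous.
by move=> i _; apply: cvgM; [exact: cvg_cst | exact: cg].
Qed.

Lemma within_continuous_dot {T : topologicalType} {d : nat} (S : set T)
    (f : T -> 'rV[R]_d) (n : 'rV[R]_d) : {within S, continuous f} ->
  {within S, continuous (fun z => dot (f z) n)}.
Proof.
move=> cf; apply: (@within_continuous_comp _ _ _ S f (dot_with n)) => //.
by move=> x _; exact: dot_continuous.
Qed.

End LinearExtension.

Section BoundaryJacobian.
Context {R : realType} {d : nat}.
Context {Omega Gamma U W : set 'rV[R]_d} {t1 t2 : R} {z0 : 'rV[R]_d} {t0 : R}.
Context (oW : open W) (GW : Gamma = boundary Omega `&` W) (Gz0 : Gamma z0)
  (oU : open U) (Uz0 : U z0) (t0I : t1 < t0 < t2).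

Local Notation Q := ((Omega `&` U) `*` `]t1, t2[).
Local Notation S := ((Omega `&` U `|` Gamma) `*` `]t1, t2[).

(** Both sides are linear in w and agree on inward directions.  Any w becomes
    inward after adding a large multiple of the vertical e, on which the graph
    function has slope -1. *)
Lemma boundary_slope (e : 'rV[R]_d) (F : 'rV[R]_d -> R) (f : 'rV[R]_d * R -> R)
    (g : 'I_d -> 'rV[R]_d * R -> R) : (forall x, differentiable F x) ->
  local_epigraph Omega z0 e F ->
  {within S, continuous f} -> (forall z, Q z -> differentiable f z) ->
  (forall x t, Gamma x -> t1 < t < t2 -> f (x, t) = 0) ->
  (forall i, {within S, continuous (g i)}) ->
  (forall i z, Q z -> 'D_(delta_mx 0 i, 0) f z = g i z) ->
  forall w : 'rV[R]_d, \sum_(i < d) w 0 i * g i (z0, t0) =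
    - 'D_w (graph_fun e F) z0 * \sum_(i < d) e 0 i * g i (z0, t0).
Proof.
move=> dF epi cf df f0 cg fg w.
have dG : differentiable (graph_fun e F) z0 by exact: graph_fun_differentiable.
pose A (u : 'rV[R]_d) z := \sum_(i < d) u 0 i * g i z.
have fA u z : Q z -> 'D_(u, 0) f z = A u z.
  move=> Qz; rewrite derive_coord_sum; last exact: df.
  by apply: eq_bigr => i _; rewrite fg.
have slope u : 'D_u (graph_fun e F) z0 < 0 ->
    A u (z0, t0) = - 'D_u (graph_fun e F) z0 * A e (z0, t0).
  by apply: (boundary_slope_inward oW GW Gz0 oU Uz0 t0I dF epi cf df f0);
    [exact: within_continuous_coord_sum | move=> z; exact: fA
    |exact: within_continuous_coord_sum | move=> z; exact: fA].
have De : 'D_e (graph_fun e F) z0 = -1.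
  apply/cvg_lim => //; apply: (@cvg_trans _ ((-1 : R) @[_ --> (0 : R)^'])).
    apply: near_eq_cvg; near=> s; rewrite /= [s *: e + _]addrC graph_fun_shift; last by case: epi.
    have s0 : s != 0 by near: s; exact: nbhs_dnbhs_neq.
    by rewrite addrAC subrr sub0r scalerN /GRing.scale /= mulVf.
  exact: cvg_cst.
pose lam := `|'D_w (graph_fun e F) z0| + 1.
have Dw : 'D_(w + lam *: e) (graph_fun e F) z0 = 'D_w (graph_fun e F) z0 - lam.
  by move: De; rewrite !deriveE // linearD linearZ /= => ->; rewrite /GRing.scale /= mulrN1.
have Aw : A (w + lam *: e) (z0, t0) = A w (z0, t0) + lam * A e (z0, t0).
  rewrite /A mulr_sumr -big_split /=; apply: eq_bigr => i _.
  by rewrite !mxE mulrDl mulrA.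
have := slope (w + lam *: e); rewrite Dw Aw -/(A w _) -/(A e _).
have -> : 'D_w (graph_fun e F) z0 - lam < 0.
  by have := ler_norm ('D_w (graph_fun e F) z0); rewrite /lam; lra.
by move=> /(_ isT) E; apply/eqP; rewrite -subr_eq0; apply/eqP; lra.
Unshelve. all: by end_near. Qed.

(** If g were nonzero at (z0, t0), the increment of p over a fixed short time
    interval would stay away from zero at interior points near z0, whereas p
    tends to zero there at both ends of the interval. *)
Lemma time_derivative_boundary0 (p g : 'rV[R]_d * R -> R) :
  {within S, continuous p} -> (forall z, Q z -> differentiable p z) ->
  (forall x t, Gamma x -> t1 < t < t2 -> p (x, t) = 0) ->
  {within S, continuous g} -> (forall z, Q z -> 'D_(0, 1) p z = g z) ->
  closure (Omega `&` U) z0 -> g (z0, t0) = 0.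
Proof.
move=> cp dp p0 cg pg clz0; apply/eqP; apply: contraT => gz0.
set a := `|g (z0, t0)|.
have a0 : 0 < a by rewrite normr_gt0.
have inT (t : R) : t1 < t < t2 -> `]t1, t2[%classic t by rewrite /= in_itv.
have S0 (t : R) : t1 < t < t2 -> S (z0, t) by move=> /inT tI; split => //; right.
have a20 : 0 < a / 2 by rewrite divr_gt0.
have [r /= r0 rP] := (nbhs_ballP _ _).1 (within_continuous_near cg (S0 _ t0I) a20).
pose s := Num.min (r / 2) ((t2 - t0) / 2).
have s0 : 0 < s by rewrite lt_min !divr_gt0 ?subr_gt0 //; case/andP: t0I.
have sr : s < r.
  have : s <= r / 2 by rewrite ge_min lexx.
  lra.
have st : t0 + s < t2.
  have : s <= (t2 - t0) / 2 by rewrite ge_min lexx orbT.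
  have : t0 < t2 by case/andP: t0I.
  lra.
clearbody s.
have t0sI : t1 < t0 + s < t2.
  by rewrite st andbT; case/andP: t0I => ? _; apply: lt_trans (_ : t0 < _); rewrite ?ltrDl.
have e0 : 0 < s * a / 4 by rewrite divr_gt0 // mulr_gt0.
have slice (t : R) : t1 < t < t2 ->
    \forall x \near z0, (Omega `&` U) x -> `|p (x, t)| < s * a / 4.
  move=> tI; have [u /= u0 uP] := (nbhs_ballP _ _).1 (within_continuous_near cp (S0 _ tI) e0).
  apply/nbhs_ballP; exists u => // x zx Ox.
  have := uP (x, t); rewrite p0 // sub0r normrN; apply.
    by split => //=; exact: ballxx.
  by split; [left | exact: inT].
have nz : \forall x \near z0, ball z0 r x by exact: nbhsx_ballx.
have [x [Ox [[px psx] zx]]] :=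
  clz0 _ (filterI (filterI (slice _ t0I) (slice _ t0sI)) nz).
have shift_t (u : R) : (x, t0) + u *: ((0, 1) : 'rV[R]_d * R) = (x, t0 + u).
  by congr pair; rewrite /= ?scaler0 ?addr0 // /GRing.scale /= mulr1.
have Qu u : 0 < u <= s -> Q ((x, t0) + u *: (0, 1)).
  rewrite shift_t => /andP[u0 us]; split => //; apply: inT.
  by rewrite /=; case/andP: t0I => t1t0 t0t2; apply/andP; split; lra.
have Sx : S (x, t0) by split; [left | exact: inT].
have [xi /andP[xi0 xis]] := MVT_ray s0 cp (@interior_sub_closed _ _ _ _ _ _ _) dp Sx Qu.
have Qxi : Q ((x, t0) + xi *: (0, 1)) by apply: Qu; rewrite xi0 ltW.
rewrite pg //.
have gxi : `|g (z0, t0) - g ((x, t0) + xi *: (0, 1))| < a / 2.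
  apply: rP; last exact: interior_sub_closed.
  rewrite shift_t; split => //=.
  by rewrite /ball /= opprD addrA subrr sub0r normrN gtr0_norm //; exact: lt_trans sr.
move: gxi; rewrite shift_t; set gx := g (x, _) => gxi E.
have : s * `|gx| < s * (a / 2).
  rewrite -{1}(gtr0_norm s0) -normrM -E shift_t.
  apply: le_lt_trans (ler_normB _ _) _.
  have := px Ox; have := psx Ox; lra.
rewrite ltr_pM2l // => gx2.
have := ler_normD (g (z0, t0) - gx) gx; rewrite subrK -/a; lra.
Qed.

End BoundaryJacobian.

(** * Flux dominated by a density vanishing on Gamma *)

Section DegenerateDensity.
Context {R : realType} {d : nat}.
Context {Omega Gamma U W : set 'rV[R]_d} {t1 t2 c : R}.
Context {p : 'rV[R]_d * R -> R} {J : 'rV[R]_d * R -> 'rV[R]_d}.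
Context (oO : open Omega) (oW : open W) (GW : Gamma = boundary Omega `&` W)
  (oU : open U) (GU : Gamma `<=` U).

Local Notation Q := ((Omega `&` U) `*` `]t1, t2[).
Local Notation S := ((Omega `&` U `|` Gamma) `*` `]t1, t2[).

Context (cp : {within S, continuous p}) (cJ : {within S, continuous J})
  (dp : forall z, Q z -> differentiable p z)
  (dJ : forall z, Q z -> differentiable J z)
  (p0 : forall x t, Gamma x -> t1 < t < t2 -> p (x, t) = 0).

Lemma closure_patch z0 : Gamma z0 -> closure (Omega `&` U) z0.
Proof.
move=> Gz0 B nB; have [clz _] : boundary Omega z0 by move: Gz0; rewrite GW => -[].
have nU : nbhs z0 U by apply: open_nbhs_nbhs; split => //; exact: GU.
by have [x [Ox [Bx Ux]]] := clz _ (filterI nB nU); exists x.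
Qed.

Section NormalDerivative.
Context {z0 n : 'rV[R]_d} {t0 : R}.
Context (Gz0 : Gamma z0) (t0I : t1 < t0 < t2).

(** The derivative matrix at z0 has rank one by [boundary_slope], so its trace is a
    multiple of the normal component of the vertical derivative; the continuity
    equation makes this trace the time derivative of -p, which is zero. *)
Lemma normal_flux_slope0 (g : 'I_d -> 'rV[R]_d * R -> 'rV[R]_d) :
  (forall z, Q z -> dt p z + div J z = 0) ->
  (forall x t, Gamma x -> t1 < t < t2 -> J (x, t) = 0) ->
  (forall i, {within S, continuous (g i)}) ->
  (forall i z, Q z -> 'D_(delta_mx 0 i, 0) J z = g i z) ->
  outer_unit_normal Omega z0 n ->
  forall w : 'rV[R]_d, \sum_(i < d) w 0 i * dot (g i (z0, t0)) n = 0.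
Proof.
move=> cont J0 cg Jg [e [F [[dF _] epi ->]]].
have Uz0 := GU Gz0.
have dot_delta (x : 'rV[R]_d) i : dot x (delta_mx 0 i) = x 0 i.
  rewrite /dot (bigD1 i) //= big1 ?mxE ?eqxx ?mulr1 ?addr0 // => j ji.
  by rewrite mxE eqxx (negbTE ji) mulr0.
have delta_sum (X : 'I_d -> R) j : \sum_(i < d) (delta_mx 0 j : 'rV[R]_d) 0 i * X i = X j.
  rewrite (bigD1 j) //= big1 ?mxE ?eqxx ?mul1r ?addr0 // => i ij.
  by rewrite mxE eqxx (negbTE ij) mul0r.
have slope m (w : 'rV[R]_d) : \sum_(i < d) w 0 i * dot (g i (z0, t0)) m =
    - 'D_w (graph_fun e F) z0 * \sum_(i < d) e 0 i * dot (g i (z0, t0)) m.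
  apply: (boundary_slope oW GW Gz0 oU Uz0 t0I dF epi
    (f := fun z => dot (J z) m) (g := fun i z => dot (g i z) m)).
  - exact: within_continuous_dot.
  - by move=> z Qz; apply: differentiable_dot; exact: dJ.
  - by move=> x t Gx tI; rewrite J0 // dotE mul0mx mxE.
  - by move=> i; exact: within_continuous_dot.
  - by move=> i z Qz; rewrite derive_dot ?Jg //; exact: dJ.
have trace0 : \sum_(i < d) g i (z0, t0) 0 i = 0.
  (* The coefficients -1 turn minus the trace into a coordinate sum. *)
  pose tr z := \sum_(i < d) (const_mx (-1) : 'rV[R]_d) 0 i * dot (g i z) (delta_mx 0 i).
  have trE z : tr z = - \sum_(i < d) g i z 0 i.
    rewrite /tr -sumrN; apply: eq_bigr => i _.
    by rewrite mxE mulN1r dot_delta.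
  apply: oppr_inj; rewrite -trE oppr0.
  apply: (time_derivative_boundary0 Gz0 t0I cp dp p0).
  - apply: within_continuous_coord_sum => i; exact: within_continuous_dot.
  - move=> z Qz; rewrite trE; apply/eqP; rewrite -addr_eq0; apply/eqP.
    rewrite -[RHS](cont z Qz); congr (_ + _); apply: eq_bigr => i _.
    rewrite -(Jg i z Qz) -dot_delta -derive_dot; last exact: dJ.
    by congr (derive _ z _); apply/funext => u; rewrite dot_delta.
  - exact: closure_patch.
set G := grad (graph_fun e F) z0.
have vertical0 : \sum_(i < d) e 0 i * dot (g i (z0, t0)) G = 0.
  have diag j : g j (z0, t0) 0 j =
      - (\sum_(i < d) G 0 j * (e 0 i * g i (z0, t0) 0 j)).
    have := slope (delta_mx 0 j) (delta_mx 0 j).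
    rewrite delta_sum dot_delta => ->; rewrite -mulr_sumr -mulNr.
    congr (- _ * _); first by rewrite /G /grad mxE.
    by apply: eq_bigr => i _; rewrite dot_delta.
  move: trace0; rewrite (eq_bigr _ (fun j _ => diag j)) sumrN => /eqP.
  rewrite oppr_eq0 => /eqP E; rewrite -[RHS]E exchange_big /=; apply: eq_bigr => i _.
  by rewrite /dot mulr_sumr; apply: eq_bigr => j _; rewrite [RHS]mulrC mulrA.
move=> w; rewrite slope.
under eq_bigr do rewrite dotZr mulrCA.
by rewrite -mulr_sumr vertical0 !mulr0.
Qed.

End NormalDerivative.

(** The chart comes from the Lipschitz regularity of the boundary, because a
    globally Lipschitz graph function compares heights with distances without
    any localization of the constant. *)
Lemma density_lower_bound z0 (t0 : R) : 0 < c ->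
  (forall x t, (Omega `&` U) x -> t1 < t < t2 -> c * dist x Gamma <= p (x, t)) ->
  (forall z, boundary Omega z ->
     exists e F (k : R), k.-lipschitz F /\ local_epigraph Omega z e F) ->
  Gamma z0 ->
  exists e F C, [/\ continuous F, local_epigraph Omega z0 e F, 0 < C &
    \forall z \near (z0, t0), Q z ->
      0 < - graph_fun e F z.1 /\ - graph_fun e F z.1 <= C * p z].
Proof.
move=> c0 pc lip Gz0.
have bz0 : boundary Omega z0 by move: Gz0; rewrite GW => -[].
have [e [F [k [lipF epi]]]] := lip _ bz0.
have [C C0 hC] := lipschitz_height_le_dist lipF oO epi GW Gz0.
have cF : continuous F by exact: lipschitz_continuous lipF.
exists e, F, (C / c); split => //; first by rewrite divr_gt0.
have nC := near_base_point (t0 := t0) hC.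
have nepi := near_base_point (t0 := t0) epi.2.
near=> z => -[[Oz Uz] tz]; split.
  have : Omega z.1 <-> graph_fun e F z.1 < 0 by near: z; exact: nepi.
  by case=> /(_ Oz); rewrite oppr_gt0.
have : - graph_fun e F z.1 <= C * dist z.1 Gamma by near: z; exact: nC.
move/le_trans; apply; rewrite -mulrA ler_pM2l // ler_pdivlMl //.
by rewrite [z in p z]surjective_pairing pc //; move: tz; rewrite /= in_itv.
Unshelve. all: by end_near. Qed.

Lemma enorm_continuous : continuous (@enorm R d).
Proof.
move=> x; apply: (@continuous_comp _ _ _ (fun y : 'rV[R]_d => dot y y) Num.sqrt).
  apply: differentiable_continuous.
  have -> : (fun y : 'rV[R]_d => dot y y) =
      \sum_(i < d) ((fun y : 'rV[R]_d => y 0 i : R) * (fun y : 'rV[R]_d => y 0 i : R)).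
    by apply/funext => y; rewrite fct_sumE.
  apply: (@differentiable_sum _ 'rV[R]_d R) => i.
  by apply: differentiableM; exact: differentiable_coord.
exact: sqrt_continuous.
Qed.

(** The velocity is continuous where p > 0, so a violation of the bound at one
    point would persist on a cube. *)
Lemma flux_le_density : ess_bounded Q (velocity p J) ->
  exists2 M, 0 <= M & forall z, Q z -> 0 < p z -> enorm (J z) <= M * p z.
Proof.
move=> [M nullM]; exists `|M| => // z Qz pz; rewrite leNgt; apply/negP => Mz.
have enormZ (a : R) (x : 'rV[R]_d) : 0 < a -> enorm (a *: x) = a * enorm x.
  move=> a0; rewrite /enorm dotZl dotZr mulrA -expr2 sqrtrM ?sqr_ge0 //.
  by rewrite sqrtr_sqr gtr0_norm.
have Mv : M < enorm (velocity p J z).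
  rewrite /velocity enormZ ?invr_gt0 // mulrC ltr_pdivlMr //.
  by apply: le_lt_trans Mz; rewrite ler_pM2r // ler_norm.
have cv : {for z, continuous (@enorm R d \o velocity p J)}.
  apply: continuous_comp; last exact: enorm_continuous.
  apply: continuousZ; last exact/differentiable_continuous/dJ.
  by apply: continuousV; [rewrite gt_eqF | exact/differentiable_continuous/dp].
have nv : \forall y \near z, M < enorm (velocity p J y) by exact: (cvgr_gt _ cv).
have nQ : nbhs z Q.
  case: z Qz {pz Mz Mv cv nv} => x t [/= [Ox Ux] tI].
  exists (Omega `&` U, `]t1, t2[%classic) => //=; split.
    by apply: filterI; exact: open_nbhs_nbhs.
  by apply: open_nbhs_nbhs; split => //; exact: interval_open.
have [r /= r0 rP] := (nbhs_ballP _ _).1 (filterI nQ nv).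
have r20 : 0 < r / 2 by rewrite divr_gt0.
apply: (@cube_not_null _ _ _ z _ r20 _ nullM) => y yz; apply: rP.
by rewrite -ball_normE /= distrC; apply: le_lt_trans yz _; lra.
Qed.

Lemma flux_boundary0 M x (t : R) : 0 <= M ->
  (forall z, Q z -> 0 < p z -> enorm (J z) <= M * p z) ->
  (\forall z \near (x, t), Q z -> 0 < p z) ->
  Gamma x -> t1 < t < t2 -> J (x, t) = 0.
Proof.
move=> M0 JM ppos Gx tI; apply/eqP; rewrite -normr_le0; apply/ler_addgt0Pl => eps eps0.
rewrite addr0.
have e0 : 0 < eps / (M + 1) by rewrite divr_gt0 // ltr_wpDl.
have tI' : `]t1, t2[%classic t by rewrite /= in_itv.
have Sx : S (x, t) by split; [right|].
have [r /= r0 rP] := (nbhs_ballP _ _).1 (filterI ppos (filterI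
  (within_continuous_near cp Sx e0) (within_continuous_near cJ Sx e0))).
have nr : \forall y \near x, ball x r y by exact: nbhsx_ballx.
have [y [Oy xy]] := closure_patch Gx nr.
have Qy : Q (y, t) by [].
have [|py [pxy Jxy]] := rP (y, t); first by split => //=; exact: ballxx.
have Sy : S (y, t) by split => //; left.
have := Jxy Sy; have := pxy Sy; rewrite p0 // sub0r normrN gtr0_norm ?py // => pe Je.
have := JM _ Qy (py Qy); have := norm_le_enorm (J (y, t)).
have := ler_normD (J (x, t) - J (y, t)) (J (y, t)); rewrite subrK.
have : (eps / (M + 1)) * (M + 1) = eps by rewrite divfK // gt_eqF // ltr_wpDl.
move: pe Je; set q := eps / _; nra.
Qed.

End DegenerateDensity.

Theorem lemma6p4 (R : realType) (d : nat)
    (Omega Gamma U : set 'rV[R]_d) (nu : 'rV[R]_d -> 'rV[R]_d) (t1 t2 c : R)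
    (p : 'rV[R]_d * R -> R) (J : 'rV[R]_d * R -> 'rV[R]_d)
    (hOmega : bounded_lipschitz_domain Omega)
    (hGamma : C1_boundary_patch Omega Gamma)
    (hnu : forall z, Gamma z -> outer_unit_normal Omega z (nu z))
    (hU : open U) (hGU : Gamma `<=` U)
    (ht : t1 < t2)
    (hJ : C1_up_to (Omega `&` U) Gamma t1 t2 J)
    (hp : C1_up_to (Omega `&` U) Gamma t1 t2 p)
    (hcont : forall x t, (Omega `&` U) x -> t1 < t < t2 ->
       dt p (x, t) + div J (x, t) = 0)
    (hp0 : forall x t, Gamma x -> t1 < t < t2 -> p (x, t) = 0)
    (hc : 0 < c)
    (hpc : forall x t, (Omega `&` U) x -> t1 < t < t2 ->
       c * dist x Gamma <= p (x, t))
    (hv : ess_bounded ((Omega `&` U) `*` `]t1, t2[) (velocity p J))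
    (hflux : forall x t, Gamma x -> t1 < t < t2 -> dot (J (x, t)) (nu x) = 0) :
  forall (W : set 'rV[R]_d) (N : 'rV[R]_d -> 'rV[R]_d),
    open W -> Gamma `<=` W ->
    (forall x, W x -> {for x, continuous N}) ->
    (forall x, Gamma x -> N x = nu x) ->
  forall (K : set 'rV[R]_d) (I : set R),
    compact K -> K `<=` Gamma -> compact I -> I `<=` `]t1, t2[ ->
  forall eps : R, 0 < eps ->
  exists2 delta : R, 0 < delta &
    forall z x t, K z -> (Omega `&` U `&` W) x -> I t ->
      enorm (x - z) < delta ->
      `|dot (velocity p J (x, t)) (N x)| < eps.
Proof.
move=> V N oV GV cN Nnu K I cK KG cI IT eps eps0.
have [oO _ _ _ lip] := hOmega.
have [[W oW GW] _] := hGamma.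
have [cJ dJ eJ] := hJ.
have [cp dp _] := hp.
have [M M0 JM] := flux_le_density oO hU dp dJ hv.
have lower z0 t0 := @density_lower_bound _ _ _ _ _ _ t1 t2 c p oO GW z0 t0 hc hpc lip.
have J0 x t : Gamma x -> t1 < t < t2 -> J (x, t) = 0.
  move=> Gx tI; apply: (flux_boundary0 GW hU hGU cp cJ hp0 M0 JM) => //.
  have [e [F [C [_ _ C0]]]] := lower x t Gx.
  apply: filterS => z H /H [h1 h2].
  by rewrite -(pmulr_rgt0 _ C0); exact: lt_le_trans h2.
have /choice[g gP] : forall i : 'I_d, exists h : 'rV[R]_d * R -> 'rV[R]_d,
    {within (Omega `&` U `|` Gamma) `*` `]t1, t2[, continuous h} /\
    (forall z, ((Omega `&` U) `*` `]t1, t2[) z -> 'D_(delta_mx 0 i, 0) J z = h z).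
  by move=> i; have [h ch Jh] := eJ (delta_mx 0 i, 0); exists h.
have contQ z : ((Omega `&` U) `*` `]t1, t2[) z -> dt p z + div J z = 0.
  by case: z => x t [/= Ox tI]; apply: hcont => //; move: tI; rewrite in_itv.
have local z0 t0 : Gamma z0 -> t1 < t0 < t2 -> \forall z \near (z0, t0),
    ((Omega `&` U) `*` `]t1, t2[) z -> `|dot (velocity p J z) (N z.1)| < eps.
  move=> Gz0 t0I.
  have [e [F [C [cF epi C0 low]]]] := lower z0 t0 Gz0.
  (* C pays for the expansion of J . nu, and d * M for replacing nu by N. *)
  pose B := C + d%:R * M + 1.
  have B0 : 0 < B by rewrite /B ltr_wpDl // addr_ge0 ?mulr_ge0 // ltW.
  have eta0 : 0 < eps / B by rewrite divr_gt0.
  have slope0 := normal_flux_slope0 oW GW hU hGU cp cJ dp dJ hp0 Gz0 t0I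
    contQ J0 (fun i => (gP i).1) (fun i => (gP i).2) (hnu _ Gz0).
  have nvert : \forall z \near (z0, t0), ((Omega `&` U) `*` `]t1, t2[) z ->
      `|dot (J z) (nu z0)| <= eps / B * - graph_fun e F z.1.
    have : \forall z \near (z0, t0), ((Omega `&` U) `*` `]t1, t2[) z ->
        `|dot (J z) (nu z0) + graph_fun e F z.1 *
          (\sum_(i < d) e 0 i * dot (g i (z0, t0)) (nu z0))|
        <= eps / B * - graph_fun e F z.1; last first.
      by apply: filterS => z; rewrite slope0 mulr0 addr0.
    apply: (vertical_slope oW GW Gz0 hU (hGU _ Gz0) t0I cF epi
      (f := fun z => dot (J z) (nu z0))
      (g := fun z => \sum_(i < d) e 0 i * dot (g i z) (nu z0))) => //.
    - exact: within_continuous_dot.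
    - by move=> z Qz; apply: differentiable_dot; exact: dJ.
    - by move=> x t Gx tI; rewrite J0 // dotE mul0mx mxE.
    - apply: within_continuous_coord_sum => i; apply: within_continuous_dot.
      exact: (gP i).1.
    - move=> z Qz; rewrite derive_dot; last exact: dJ.
      rewrite derive_coord_sum; last exact: dJ.
      rewrite dot_suml; apply: eq_bigr => i _.
      by rewrite dotZl (gP i).2.
  have cN0 : {for z0, continuous N} by apply: cN; exact: GV.
  have nN := near_base_point (t0 := t0) ((cvgrPdist_lt _ _).1 cN0 _ eta0).
  near=> z => Qz.
  have [h0 hC] : 0 < - graph_fun e F z.1 /\ - graph_fun e F z.1 <= C * p z.
    by move: Qz; near: z; exact: low.
  have Jnu : `|dot (J z) (nu z0)| <= eps / B * - graph_fun e F z.1.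
    by move: Qz; near: z; exact: nvert.
  have NN : `|N z0 - N z.1| < eps / B by near: z; exact: nN.
  have pz : 0 < p z by rewrite -(pmulr_rgt0 _ C0); exact: lt_le_trans hC.
  have Jz := le_trans (norm_le_enorm (J z)) (JM z Qz pz).
  rewrite /velocity dotZl normrM gtr0_norm ?invr_gt0 // mulrC ltr_pdivrMr //.
  have -> : dot (J z) (N z.1) = dot (J z) (nu z0) - dot (J z) (N z0 - N z.1).
    by rewrite dotBr (Nnu _ Gz0); ring.
  apply: le_lt_trans (ler_normB _ _) _.
  have E1 : `|dot (J z) (nu z0)| <= eps / B * (C * p z).
    by apply: le_trans Jnu _; rewrite ler_pM2l.
  have E2 : `|dot (J z) (N z0 - N z.1)| <= d%:R * (M * p z) * (eps / B).
    apply: le_trans (dot_le_norm _ _) _.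
    by rewrite ler_pM ?mulr_ge0 ?ler_wpM2l // ltW.
  apply: le_lt_trans (lerD E1 E2) _.
  have -> : eps / B * (C * p z) + d%:R * (M * p z) * (eps / B) =
    (eps / B * p z) * (B - 1) by rewrite /B; ring.
  have -> : eps * p z = (eps / B * p z) * B by field; rewrite gt_eqF.
  by rewrite ltr_pM2l; [lra | rewrite mulr_gt0].
have compactKI := compact_setX cK cI.
have /compact_near_coveringP/(_ R 0^'+ (fun delta (z : 'rV[R]_d * R) =>
  forall x, (Omega `&` U `&` V) x -> I z.2 -> enorm (x - z.1) < delta ->
    `|dot (velocity p J (x, z.2)) (N x)| < eps) _) cover := compactKI.
have nunif : \forall delta \near (0 : R)^'+, K `*` I `<=` (fun z : 'rV[R]_d * R =>
  forall x, (Omega `&` U `&` V) x -> I z.2 -> enorm (x - z.1) < delta ->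
    `|dot (velocity p J (x, z.2)) (N x)| < eps).
  apply: cover => -[z0 t0] [/= Kz0 It0].
  have t0I : t1 < t0 < t2 by have := IT _ It0; rewrite /= in_itv.
  have [r /= r0 rP] := (nbhs_ballP _ _).1 (local _ _ (KG _ Kz0) t0I).
  have r20 : 0 < r / 2 by rewrite divr_gt0.
  exists (ball (z0, t0) (r / 2), [set delta | delta < r / 2]) => /=.
    by split; [exact: nbhsx_ballx | exact: nbhs_right_lt].
  move=> [[z t] delta] /= [[/= zz0 tt0] dr] x [Oxx _] It xz.
  apply: (rP (x, t)); last by split => //; exact: IT.
  split => /=; last by apply: le_ball tt0; lra.
  move: zz0; rewrite -!ball_normE /= => zz0; move: xz => /= xz.
  have := ler_distD z z0 x; have := norm_le_enorm (x - z).
  by rewrite (distrC x z); move: (enorm _) xz => u xz; lra.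
near (0 : R)^'+ => delta.
exists delta; first by near: delta; exact: nbhs_right_gt.
move=> z x t Kz Ox It xz.
have H : K `*` I `<=` (fun z : 'rV[R]_d * R =>
  forall x, (Omega `&` U `&` V) x -> I z.2 -> enorm (x - z.1) < delta ->
    `|dot (velocity p J (x, z.2)) (N x)| < eps) by near: delta; exact: nunif.
exact: (H (z, t) (conj Kz It)).
Unshelve. all: by end_near. Qed.
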